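(* If $\beta > \gamma$, then the solution $x_N$ of the truncated system $$x_{N,i} = b_i + \sum_{j=0}^{i-1} \frac{1}{\alpha_1}\omega_{ij}F_{ij}(x_{N,j}) + \sum_{j=i}^{N}\frac{1}{\beta}\varphi_{ij}G_{ij}(x_{N,j}), \quad 0\le i\le N,$$ converges to the exact solution $x$ of the infinite-dimensional system $$x_i = b_i + \sum_{j=0}^{i-1} \frac{1}{\alpha_1}\omega_{ij}F_{ij}(x_j) + \sum_{j=i}^{\infty}\frac{1}{\beta}\varphi_{ij}G_{ij}(x_j), \quad i\ge 0,$$ in the sense that $$\lim_{N\to\infty}\|x_N - (x)_N\|_\infty = 0,$$ where $(x)_N$ denotes the truncation of $x$ to its entries with index $0\le i\le N$, i.e. $\|x_N-(x)_N\|_\infty = \max_{0\le i\le N}|x_{N,i}-x_i|$.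
   Context: Fix a norm $|\cdot|$ on $\mathbb{R}^n$ and a step size $h>0$. The real constants $\alpha_1,\alpha_2,\beta,\gamma$ satisfy $\alpha_1 \ne 0$, $\alpha_2 \ge 0$, $\alpha_1 \le \alpha_2$, $\beta > 0$, $\beta \ge \gamma$. The data are a function $x_0:[0,\infty)\to\mathbb{R}^n$ and $\mathbb{R}^n$-valued functions $f(t,s,x)$, defined for $0\le s\le t<\infty$, $x\in S$, and $g(t,s,x)$, defined for $0\le t\le s<\infty$, $x\in S$. Standing assumptions: (i) $f$ and $g$ are Lipschitz in $x\in S$ uniformly in $(t,s)$ in their respective domains, with Lipschitz constants $L_f$, $L_g$ satisfying $\frac{L_f}{|\alpha_1|} + \frac{L_g}{\beta} < 1$. (ii) $f$ and $g$ are continuous in all their arguments on their respective domains, and $|f|\le C_f$, $|g|\le C_g$ there, for constants $C_f,C_g$. (iii) $S = \{x\in\mathbb{R}^n : |x| \le \|x_0\|_\infty + \frac{C_f}{|\alpha_1|} + \frac{C_g}{\beta}\}$, where $\|x_0\|_\infty=\sup_{t\ge 0}|x_0(t)|$. (iv) $f$ and $g$ are continuously differentiable in $s$ and in $t$ on their respective domains, with bounded partial derivatives. (v) $x_0(\cdot)$ is bounded and differentiable with bounded derivative on $[0,\infty)$. Notation: $b_i = x_0(ih)$, $F_{ij}(\xi) = f(ih,jh,\xi)$ for $0\le j\le i-1$, $G_{ij}(\xi) = g(ih,jh,\xi)$ for $j\ge i$ (with $\xi\in S$), and $$\omega_{ij} = e^{(\alpha_1 j-\alpha_2 i)h}\,[e^{\alpha_1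 h}-1], \qquad \varphi_{ij} = e^{(-\beta j+\gamma i)h}\,[1-e^{-\beta h}].$$ The solution $x=\{x_i\}_{i\ge 0}$ of the infinite-dimensional system is its unique solution with all $x_i\in S$; the solution $x_N=(x_{N,i})_{0\le i\le N}$ of the truncated system is its unique solution with all $x_{N,i}\in S$. Empty sums are zero. *)

(* Defs.v *)
From HB Require Import structures.
From mathcomp Require Import all_boot all_order all_algebra.
From mathcomp Require Import all_classical all_reals all_analysis.
Import Order.TTheory GRing.Theory Num.Theory.
Import numFieldNormedType.Exports.

Set Implicit Arguments.
Unset Strict Implicit.
Unset Printing Implicit Defensive.

Local Open Scope classical_set_scope.
Local Open Scope ring_scope.

(* R^n is 'rV[R]_n.  The norm of the theory is an arbitrary function [nrm]
   satisfying [is_norm]; limits and continuity are taken in the library topology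
   of 'rV[R]_n, which is the one induced by any such norm since the dimension is
   finite. *)
Definition is_norm (R : realType) (n : nat) (nrm : 'rV[R]_n -> R) : Prop :=
  [/\ forall x y, nrm (x + y) <= nrm x + nrm y,
      forall (a : R) x, nrm (a *: x) = `|a| * nrm x
    & forall x, nrm x = 0 -> x = 0].

Definition sup_norm (R : realType) (n : nat) (nrm : 'rV[R]_n -> R)
    (u : R -> 'rV[R]_n) : R :=
  sup [set nrm (u t) | t in [set t | 0 <= t]].

(* Time pairs are always written (t, s), in the order of the arguments of
   f(t, s, x) and g(t, s, x). *)
Definition dom_f (R : realType) : set (R * R) := [set p | 0 <= p.2 <= p.1].
Definition dom_g (R : realType) : set (R * R) := [set p | 0 <= p.1 <= p.2].
Arguments dom_f : clear implicits.
Arguments dom_g : clear implicits.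

Definition lipschitz_in_state (R : realType) (n : nat) (nrm : 'rV[R]_n -> R)
    (D : set (R * R)) (S : set 'rV[R]_n) (L : R)
    (f : R -> R -> 'rV[R]_n -> 'rV[R]_n) : Prop :=
  forall t s x y, D (t, s) -> S x -> S y ->
    nrm (f t s x - f t s y) <= L * nrm (x - y).

Definition continuous_on_dom (R : realType) (n : nat)
    (D : set (R * R)) (S : set 'rV[R]_n)
    (f : R -> R -> 'rV[R]_n -> 'rV[R]_n) : Prop :=
  {within [set p : R * R * 'rV[R]_n | D p.1 /\ S p.2],
    continuous (fun p : R * R * 'rV[R]_n => f p.1.1 p.1.2 p.2)}.

Definition bounded_on_dom (R : realType) (n : nat) (nrm : 'rV[R]_n -> R)
    (D : set (R * R)) (S : set 'rV[R]_n) (C : R)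
    (f : R -> R -> 'rV[R]_n -> 'rV[R]_n) : Prop :=
  forall t s x, D (t, s) -> S x -> nrm (f t s x) <= C.

(* [l] is the derivative at [t] of [u] as a function on [A]: the increments are
   those that stay in [A], so the derivative is one-sided at an endpoint of an
   interval (and unconstrained at an isolated point of [A]). *)
Definition has_deriv_within (R : realType) (n : nat) (A : set R)
    (u : R -> 'rV[R]_n) (t : R) (l : 'rV[R]_n) : Prop :=
  k^-1 *: (u (t + k) - u t) @[k --> within [set k | A (t + k)] 0^'] --> l.

(* [ft] and [fs] are the partial derivatives of [f] in t and in s; they are
   continuous in (t, s) for each x, up to the boundary of the domain. *)
Definition C1_in_time_bounded (R : realType) (n : nat) (nrm : 'rV[R]_n -> R)
    (D : set (R * R)) (S : set 'rV[R]_n)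
    (f : R -> R -> 'rV[R]_n -> 'rV[R]_n) : Prop :=
  exists ft fs : R -> R -> 'rV[R]_n -> 'rV[R]_n,
    [/\ forall t s x, D (t, s) -> S x ->
          has_deriv_within [set t' | D (t', s)] (fun t' => f t' s x) t
            (ft t s x),
        forall t s x, D (t, s) -> S x ->
          has_deriv_within [set s' | D (t, s')] (fun s' => f t s' x) s
            (fs t s x),
        forall x, S x ->
          {within D, continuous (fun p : R * R => ft p.1 p.2 x)} /\
          {within D, continuous (fun p : R * R => fs p.1 p.2 x)}
      & exists M, bounded_on_dom nrm D S M ft /\ bounded_on_dom nrm D S M fs].

Definition bounded_on_halfline (R : realType) (n : nat) (nrm : 'rV[R]_n -> R)
    (u : R -> 'rV[R]_n) : Prop :=
  exists M : R, forall t, 0 <= t -> nrm (u t) <= M.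

Definition omega (R : realType) (h alpha1 alpha2 : R) (i j : nat) : R :=
  expR ((alpha1 * j%:R - alpha2 * i%:R) * h) * (expR (alpha1 * h) - 1).

Definition phi (R : realType) (h beta gamma : R) (i j : nat) : R :=
  expR ((- beta * j%:R + gamma * i%:R) * h) * (1 - expR (- beta * h)).

Section Systems.
Context (R : realType) (n : nat) (h alpha1 alpha2 beta gamma : R).
Context (x0 : R -> 'rV[R]_n) (f g : R -> R -> 'rV[R]_n -> 'rV[R]_n).

Definition b_ (i : nat) : 'rV[R]_n := x0 (i%:R * h).
Definition F_ (i j : nat) : 'rV[R]_n -> 'rV[R]_n := f (i%:R * h) (j%:R * h).
Definition G_ (i j : nat) : 'rV[R]_n -> 'rV[R]_n := g (i%:R * h) (j%:R * h).

Definition past_sum (x : nat -> 'rV[R]_n) (i : nat) : 'rV[R]_n :=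
  \sum_(0 <= j < i) (1 / alpha1 * omega h alpha1 alpha2 i j) *: F_ i j (x j).

Definition future_term (x : nat -> 'rV[R]_n) (i j : nat) : 'rV[R]_n :=
  (1 / beta * phi h beta gamma i j) *: G_ i j (x j).

Definition infinite_solution (S : set 'rV[R]_n) (x : nat -> 'rV[R]_n) : Prop :=
  forall i, [/\ S (x i),
    cvgn (fun M => \sum_(i <= j < M) future_term x i j)
  & x i = b_ i + past_sum x i
          + limn (fun M => \sum_(i <= j < M) future_term x i j)].

(* Only the entries [x i] with [i <= N] matter. *)
Definition truncated_solution (S : set 'rV[R]_n) (N : nat)
    (x : nat -> 'rV[R]_n) : Prop :=
  forall i, (i <= N)%N -> S (x i) /\
    x i = b_ i + past_sum x i + \sum_(i <= j < N.+1) future_term x i j.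

End Systems.

(* Main.v *)
Require Import Defs.
From mathcomp Require Import all_boot all_order all_algebra.
From mathcomp Require Import all_classical all_reals all_analysis.
From mathcomp Require Import ring lra.

Set Implicit Arguments.
Unset Strict Implicit.
Unset Printing Implicit Defensive.

Import Order.TTheory GRing.Theory Num.Theory.
Import numFieldNormedType.Exports.
Local Open Scope classical_set_scope.
Local Open Scope ring_scope.

(** The truncation error is controlled by the same contraction that makes the
    infinite system uniquely solvable.  Let E be the largest of the errors
    e_i = x_{N,i} - x_i, i <= N.  Subtracting the two systems,
      e_i = (past sum at x_N minus past sum at x)
          + (future sum over i <= j <= N at x_N minus the same sum at x)
          - (terms j > N of the series of the infinite system).
    The past and future weights are nonnegative, and because omega and phi are
    differences of consecutive exponentials their sums telescope: the past
    weights add up to at most 1/|alpha1| ([sum_past_weights_le]) and the future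
    ones to at most 1/beta ([sum_future_weights_le]), uniformly in i.  By the
    Lipschitz conditions the first two lines are thus at most
    k E with k = Lf/|alpha1| + Lg/beta < 1 ([past_sum_lip], [future_sum_lip]).

    The last line is where beta > gamma enters.  By telescoping again and
    |g| <= Cg it is at most (Cg/beta) e^{(gamma i - beta (N+1)) h}, and since
    i <= N this is at most (Cg/beta) q^(N+1) for
    q = e^{-(beta - max(gamma, 0)) h}, whatever the sign of gamma
    ([future_tail_le]).  Hence E <= k E + (Cg/beta) q^(N+1), that is
      E <= (Cg/beta) q^(N+1) / (1 - k)   ([truncation_error_le]),
    which tends to 0 because q < 1. *)

(** * Arbitrary norms on row vectors *)

Section Norm.
Context {R : realType} {n : nat} {nrm : 'rV[R]_n -> R} (hnrm : is_norm nrm).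

Lemma nrmD x y : nrm (x + y) <= nrm x + nrm y.
Proof. by case: hnrm. Qed.

Lemma nrmZ a x : nrm (a *: x) = `|a| * nrm x.
Proof. by case: hnrm. Qed.

Lemma nrm0 : nrm 0 = 0.
Proof. by rewrite -(scale0r (0 : 'rV[R]_n)) nrmZ normr0 mul0r. Qed.

Lemma nrmN x : nrm (- x) = nrm x.
Proof. by rewrite -scaleN1r nrmZ normrN1 mul1r. Qed.

Lemma nrm_ge0 x : 0 <= nrm x.
Proof. by have := nrmD x (- x); rewrite subrr nrm0 nrmN; lra. Qed.

Lemma nrm_sum (I : Type) (r : seq I) (P : pred I) (v : I -> 'rV[R]_n) :
  nrm (\sum_(i <- r | P i) v i) <= \sum_(i <- r | P i) nrm (v i).
Proof.
elim/big_ind2: _ => [|x a y b xa yb|//]; first by rewrite nrm0.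
by rewrite (le_trans (nrmD _ _))// lerD.
Qed.

Lemma nrm_weighted_sum (w : nat -> R) (v : nat -> 'rV[R]_n) (C : R)
    (a b : nat) :
  (forall j, 0 <= w j) -> (forall j, (a <= j < b)%N -> nrm (v j) <= C) ->
  nrm (\sum_(a <= j < b) w j *: v j) <= (\sum_(a <= j < b) w j) * C.
Proof.
move=> w0 vC; rewrite (le_trans (nrm_sum _ _ _))// mulr_suml.
apply: ler_sum_nat => j jab.
by rewrite nrmZ ger0_norm// ler_wpM2l// vC.
Qed.

(** Expanding in the standard basis gives the easy half of the equivalence of
    norms, which is all that links [nrm] to the topology of the row vectors. *)
Lemma nrm_le_mx_norm : exists2 K, 0 <= K & forall x, nrm x <= K * `|x|.
Proof.
exists (\sum_(j < n) nrm (delta_mx 0 j)).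
  by apply: sumr_ge0 => j _; exact: nrm_ge0.
move=> x; rewrite [in leLHS](row_sum_delta x) (le_trans (nrm_sum _ _ _))//.
rewrite mulr_suml; apply: ler_sum => j _.
rewrite nrmZ mulrC ler_wpM2l ?nrm_ge0//.
rewrite [leRHS]/Num.norm/= mx_normrE.
exact: (le_bigmax 0 (fun ij : 'I_1 * 'I_n => `|x ij.1 ij.2|) (0, j)).
Qed.

(** Limits are taken for the sup norm of the coordinates, so that bounds on
    [nrm] survive them only through [nrm_le_mx_norm]. *)
Lemma nrm_lim_le (u : nat -> 'rV[R]_n) (l : 'rV[R]_n) (C : R) :
  u M @[M --> \oo] --> l -> (\forall M \near \oo, nrm (u M) <= C) ->
  nrm l <= C.
Proof.
move=> ul uC; have [K K0 nK] := nrm_le_mx_norm.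
apply/ler_addgt0Pr => e e0.
(* K may be 0, in dimension 0: dividing by K + 1 is always safe. *)
have eK : 0 < e / (K + 1) by rewrite divr_gt0//; lra.
have [M [uM dM]] : exists M, nrm (u M) <= C /\ `|l - u M| <= e / (K + 1).
  apply: (@filter_ex _ \oo); near=> M.
  split; near: M; first exact: uC.
  by move/cvgrPdist_le : ul; apply.
rewrite -(subrK (u M) l) addrC (le_trans (nrmD _ _))//.
rewrite lerD// (le_trans (nK _))// (le_trans (ler_wpM2l K0 dM))//.
by rewrite mulrCA ger_pMr// ler_pdivrMr; lra.
Unshelve. all: by end_near. Qed.

(** Nothing prevents a Lipschitz constant from being negative when the state
    space has at most one point; two distinct points exclude it. *)
Lemma lipschitz_cst_ge0 (L : R) x y z :
  x != y -> nrm z <= L * nrm (x - y) -> 0 <= L.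
Proof.
move=> xy zL.
have d0 : 0 < nrm (x - y).
  rewrite lt_neqAle nrm_ge0 andbT; apply: contra xy => /eqP/esym d0.
  by rewrite -subr_eq0; apply/eqP; case: hnrm => _ _; apply.
by rewrite -(pmulr_lge0 _ d0) (le_trans (nrm_ge0 z)).
Qed.

End Norm.

(** * Sums of the weights *)

Section Weights.
Context {R : realType} (h alpha1 alpha2 beta gamma : R).
Hypothesis h_gt0 : 0 < h.

(** The factor e^{alpha1 h} - 1 has the sign of alpha1. *)
Lemma past_weight_ge0 i j : 0 <= 1 / alpha1 * omega h alpha1 alpha2 i j.
Proof.
rewrite /omega mulrCA mulr_ge0 ?expR_ge0// mul1r.
have [a0|a0|->] := ltgtP alpha1 0; last by rewrite invr0 mul0r.
- by rewrite nmulr_rge0 ?invr_lt0// subr_le0 expR_le1 nmulr_rle0// ltW.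
- rewrite mulr_ge0 ?invr_ge0 ?(ltW a0)// subr_ge0 leNgt expR_lt1 -leNgt.
  by rewrite mulr_ge0 ?ltW.
Qed.

Lemma sum_omega i : \sum_(0 <= j < i) omega h alpha1 alpha2 i j =
  expR (- (alpha2 * i%:R * h)) * (expR (alpha1 * i%:R * h) - 1).
Proof.
have := telescope_sumr (fun j => expR (alpha1 * j%:R * h)) (leq0n i).
rewrite mulr0 mul0r expR0 => <-; rewrite mulr_sumr.
apply: eq_bigr => j _; rewrite /omega !mulrBr -!expRD mulr1.
by congr (expR _ - expR _); rewrite -?natr1; ring.
Qed.

(** The sum is (e^{(alpha1 - alpha2) i h} - e^{- alpha2 i h}) / alpha1, and both
    exponentials lie in ]0, 1]. *)
Lemma sum_past_weights_le i :
  0 <= alpha2 -> alpha1 <= alpha2 ->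
  \sum_(0 <= j < i) (1 / alpha1 * omega h alpha1 alpha2 i j) <= `|alpha1|^-1.
Proof.
move=> a2 a12; have ih0 : 0 <= i%:R * h :> R by rewrite mulr_ge0// ltW.
rewrite -mulr_sumr sum_omega mul1r -!mulrA mulrBr mulr1 -expRD.
have e2 : expR (- (alpha2 * (i%:R * h))) <= 1.
  by rewrite expR_le1 oppr_le0 mulr_ge0.
have e2p := expR_gt0 (- (alpha2 * (i%:R * h))).
have e1 : expR (- (alpha2 * (i%:R * h)) + alpha1 * (i%:R * h)) <= 1.
  by rewrite expR_le1 addrC -mulrBl mulr_le0_ge0// subr_le0.
have e1p := expR_gt0 (- (alpha2 * (i%:R * h)) + alpha1 * (i%:R * h)).
have [a0|a0|->] := ltgtP alpha1 0; last by rewrite normr0 invr0 mul0r.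
- by rewrite ltr0_norm// invrN -[leRHS]mulrN1 ler_wnM2l ?invr_le0 ?ltW//; lra.
- by rewrite gtr0_norm// ger_pMr ?invr_gt0//; lra.
Qed.

Hypothesis beta_gt0 : 0 < beta.

Lemma future_weight_ge0 i j : 0 <= 1 / beta * phi h beta gamma i j.
Proof.
rewrite mul1r mulr_ge0 ?invr_ge0 ?(ltW beta_gt0)// mulr_ge0 ?expR_ge0//.
rewrite subr_ge0.
by rewrite expR_le1 mulNr oppr_le0 mulr_ge0 ?ltW.
Qed.

(** The bound is the exponential at the lower end of the telescoping sum; it
    does not depend on the upper end b, so it also bounds the tails of the
    series. *)
Lemma sum_future_weights_le i a b : (a <= b)%N ->
  \sum_(a <= j < b) (1 / beta * phi h beta gamma i j) <=
  beta^-1 * expR ((gamma * i%:R - beta * a%:R) * h).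
Proof.
move=> ab; rewrite -mulr_sumr mul1r ler_wpM2l ?invr_ge0 ?(ltW beta_gt0)//.
pose e j : R := - expR ((gamma * i%:R - beta * j%:R) * h).
rewrite (eq_bigr (fun j => e j.+1 - e j)) => [|j _]; last first.
  rewrite /phi /e mulrBr -expRD mulr1 opprK addrC.
  by congr (- expR _ + expR _); rewrite -?natr1; ring.
by rewrite telescope_sumr// /e opprK gerDr oppr_le0 expR_ge0.
Qed.

End Weights.

(** * Error of the truncation *)

(** The ratio of the geometric bound on the neglected terms.  Clipping gamma at
    0 covers both signs: for i <= N, gamma i is at most gamma N if gamma >= 0,
    and at most 0 otherwise. *)
Definition tail_rate (R : realType) (h beta gamma : R) : R :=
  expR (- (beta - Num.max gamma 0) * h).

Section Error.
Context {R : realType} {n : nat} {nrm : 'rV[R]_n -> R}.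
Context {h alpha1 alpha2 beta gamma Lf Lg Cg : R}.
Context {x0 : R -> 'rV[R]_n} {f g : R -> R -> 'rV[R]_n -> 'rV[R]_n}.
Context {S : set 'rV[R]_n}.
Hypothesis hnrm : is_norm nrm.
Hypothesis h_gt0 : 0 < h.
Hypothesis alpha2_ge0 : 0 <= alpha2.
Hypothesis alpha12 : alpha1 <= alpha2.
Hypothesis beta_gt0 : 0 < beta.
Hypothesis gamma_le_beta : gamma <= beta.
Hypothesis f_lip : lipschitz_in_state nrm (dom_f R) S Lf f.
Hypothesis g_lip : lipschitz_in_state nrm (dom_g R) S Lg g.
Hypothesis g_bnd : bounded_on_dom nrm (dom_g R) S Cg g.

Lemma dom_f_grid i j : (j < i)%N -> dom_f R (i%:R * h, j%:R * h).
Proof.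
move=> ji; rewrite /dom_f/= mulr_ge0 ?(ltW h_gt0)//=.
by rewrite ler_wpM2r ?ler_nat ?(ltnW ji) ?(ltW h_gt0).
Qed.

Lemma dom_g_grid i j : (i <= j)%N -> dom_g R (i%:R * h, j%:R * h).
Proof.
move=> ij; rewrite /dom_g/= mulr_ge0 ?(ltW h_gt0)//=.
by rewrite ler_wpM2r ?ler_nat ?(ltW h_gt0).
Qed.

Lemma g_bound_ge0 x : S x -> 0 <= Cg.
Proof.
move=> Sx; apply: le_trans (nrm_ge0 hnrm (g 0 0 x)) _.
by apply: g_bnd => //; rewrite /dom_g/= lexx.
Qed.

Lemma tail_weight_le i N : (i <= N)%N ->
  expR ((gamma * i%:R - beta * N%:R) * h) <= tail_rate h beta gamma ^+ N.
Proof.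
move=> iN; rewrite /tail_rate -expRM_natl ler_expR.
rewrite [leRHS]mulrA ler_wpM2r ?(ltW h_gt0)//.
have im : gamma * i%:R <= Num.max gamma 0 * N%:R.
  apply: (@le_trans _ _ (Num.max gamma 0 * i%:R)).
    by rewrite ler_wpM2r// le_max lexx.
  by rewrite ler_wpM2l ?ler_nat// le_max lexx orbT.
by lra.
Qed.

(** The partial sums of the series from index N on satisfy the bound, by
    telescoping of the weights, and it passes to the limit. *)
Lemma future_tail_le (x : nat -> 'rV[R]_n) i N :
  infinite_solution h alpha1 alpha2 beta gamma x0 f g S x -> (i <= N)%N ->
  nrm (limn (fun M => \sum_(i <= j < M) future_term h beta gamma g x i j)
       - \sum_(i <= j < N) future_term h beta gamma g x i j)
  <= Cg / beta * tail_rate h beta gamma ^+ N.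
Proof.
move=> xsol iN; have [Si cvi _] := xsol i.
apply: (@nrm_lim_le _ _ _ hnrm (fun M =>
    \sum_(i <= j < M) future_term h beta gamma g x i j
    - \sum_(i <= j < N) future_term h beta gamma g x i j)).
  by apply: cvgB => //; exact: cvg_cst.
near=> M; have NM : (N <= M)%N by near: M; exact: nbhs_infty_ge.
rewrite (big_cat_nat iN NM)/= addrAC subrr add0r.
apply: le_trans (nrm_weighted_sum hnrm (C := Cg) _ _) _ => [j|j /andP[Nj _]|].
- exact: future_weight_ge0.
- apply: g_bnd; first exact/dom_g_grid/(leq_trans iN).
  by case: (xsol j).
- have C0 := g_bound_ge0 Si; rewrite mulrC -mulrA ler_wpM2l//.
  apply: le_trans (sum_future_weights_le _ _ _ _ NM) _ => //.
  by rewrite ler_wpM2l ?invr_ge0 ?(ltW beta_gt0)// tail_weight_le.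
Unshelve. all: by end_near. Qed.

Lemma past_sum_lip (x y : nat -> 'rV[R]_n) i E :
  0 <= Lf -> 0 <= E ->
  (forall j, (j < i)%N -> [/\ S (x j), S (y j) & nrm (x j - y j) <= E]) ->
  nrm (past_sum h alpha1 alpha2 f x i - past_sum h alpha1 alpha2 f y i)
  <= Lf / `|alpha1| * E.
Proof.
move=> Lf0 E0 xy; rewrite /past_sum -sumrB.
under eq_bigr do rewrite -scalerBr.
apply: le_trans (nrm_weighted_sum hnrm (C := Lf * E) _ _) _ => [j|j /= ji|].
- exact: past_weight_ge0.
- have [Sx Sy xyE] := xy _ ji.
  apply: le_trans (f_lip (dom_f_grid ji) Sx Sy) _.
  exact: ler_wpM2l.
- rewrite [leRHS]mulrAC [leRHS]mulrC ler_wpM2r ?mulr_ge0//.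
  exact: sum_past_weights_le.
Qed.

Lemma future_sum_lip (x y : nat -> 'rV[R]_n) i N E :
  0 <= Lg -> 0 <= E -> (i <= N)%N ->
  (forall j, (j < N)%N -> [/\ S (x j), S (y j) & nrm (x j - y j) <= E]) ->
  nrm (\sum_(i <= j < N) future_term h beta gamma g x i j
       - \sum_(i <= j < N) future_term h beta gamma g y i j)
  <= Lg / beta * E.
Proof.
move=> Lg0 E0 iN xy; rewrite -sumrB /future_term.
under eq_bigr do rewrite -scalerBr.
apply: le_trans (nrm_weighted_sum hnrm (C := Lg * E) _ _) _.
- by move=> j; exact: future_weight_ge0.
- move=> j /andP[ij jN]; have [Sx Sy xyE] := xy _ jN.
  apply: le_trans (g_lip (dom_g_grid ij) Sx Sy) _.
  exact: ler_wpM2l.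
- rewrite [leRHS]mulrAC [leRHS]mulrC ler_wpM2r ?mulr_ge0//.
  apply: le_trans (sum_future_weights_le _ _ _ _ iN) _ => //.
  rewrite ger_pMr ?invr_gt0// expR_le1 -mulrBl.
  by rewrite -mulrA mulr_le0_ge0 ?subr_le0// mulr_ge0// ltW.
Qed.

(** The maximal error E satisfies E <= k E + T with k < 1, and this is solved
    for E. *)
Lemma truncation_error_le (x y : nat -> 'rV[R]_n) N :
  Lf / `|alpha1| + Lg / beta < 1 ->
  infinite_solution h alpha1 alpha2 beta gamma x0 f g S x ->
  truncated_solution h alpha1 alpha2 beta gamma x0 f g S N y ->
  \big[Num.max/0]_(i < N.+1) nrm (y i - x i) <=
  (1 - (Lf / `|alpha1| + Lg / beta))^-1 * (Cg / beta)
  * tail_rate h beta gamma ^+ N.+1.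
Proof.
move=> k1 xsol ysol; set E := \big[_/_]_(_ < _) _; set k := _ + _ in k1 *.
have C0 : 0 <= Cg by have [/g_bound_ge0] := xsol 0%N.
have T0 : 0 <= Cg / beta * tail_rate h beta gamma ^+ N.+1.
  by rewrite mulr_ge0 ?exprn_ge0 ?expR_ge0// divr_ge0// ltW.
have k1p : 0 < 1 - k by lra.
rewrite -mulrA.
have [E0|] := leP E 0.
  by rewrite (le_trans E0)// mulr_ge0 ?invr_ge0 ?(ltW k1p).
(* A positive error yields two distinct points of S, whence Lf, Lg >= 0. *)
move=> E0.
have eE j : (j < N.+1)%N -> nrm (y j - x j) <= E.
  by move=> jN; exact: (le_bigmax 0 (fun i : 'I_N.+1 => nrm (y i - x i))
                        (Ordinal jN)).
have ySE j : (j < N.+1)%N -> [/\ S (y j), S (x j) & nrm (y j - x j) <= E].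
  by move=> jN; have [? _] := ysol _ jN; have [? _ _] := xsol j; split;
    rewrite ?eE.
have [i iN yx] : exists2 i, (i < N.+1)%N & y i != x i.
  apply: contrapT => yx; move: E0; apply/negP; rewrite -leNgt.
  apply: bigmax_le => // i _.
  have [->|yxi] := eqVneq (y i) (x i); first by rewrite subrr nrm0.
  by case: yx; exists i.
have [Sy Sx _] := ySE _ iN.
have Lf0 : 0 <= Lf.
  by apply: (lipschitz_cst_ge0 hnrm yx (f_lip (t := 0) (s := 0) _ Sy Sx));
    rewrite /dom_f/= lexx.
have Lg0 : 0 <= Lg.
  by apply: (lipschitz_cst_ge0 hnrm yx (g_lip (t := 0) (s := 0) _ Sy Sx));
    rewrite /dom_g/= lexx.
suff EkT : E <= k * E + Cg / beta * tail_rate h beta gamma ^+ N.+1.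
  by rewrite mulrC ler_pdivlMr//; lra.
move=> {i iN yx Sx Sy}; apply: bigmax_le => [|[i iN] _ /=].
  rewrite addr_ge0// mulr_ge0 ?(ltW E0)// addr_ge0 ?divr_ge0//.
  exact: ltW.
have [_ ->] := ysol _ iN; have [_ _ ->] := xsol i.
set Py := past_sum _ _ _ _ _ _; set Px := past_sum _ _ _ _ _ _.
set Fy := \sum_(_ <= _ < _) _; set Fl := limn _.
(* Cutting the series of x at N isolates the tail Fl - Fx. *)
pose Fx := \sum_(i <= j < N.+1) future_term h beta gamma g x i j.
have -> : b_ h x0 i + Py + Fy - (b_ h x0 i + Px + Fl)
  = (Py - Px) + (Fy - Fx) - (Fl - Fx).
  rewrite -[RHS]addrA opprB subrKA opprD addrACA opprD.
  by rewrite [X in X + _]addrACA subrr add0r.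
apply: le_trans (nrmD hnrm _ _) _; rewrite nrmN//.
apply: lerD; last exact: future_tail_le (ltnW iN).
apply: le_trans (nrmD hnrm _ _) _; rewrite /k mulrDl.
apply: lerD.
  by apply: past_sum_lip => // [|j ji]; [exact: ltW|
    exact/ySE/(ltn_trans ji)].
by apply: future_sum_lip => //; [exact: ltW|exact: ltnW].
Qed.

End Error.

Theorem theorem3p1 (R : realType) (n : nat) (nrm : 'rV[R]_n -> R)
  (h alpha1 alpha2 beta gamma Lf Lg Cf Cg : R)
  (x0 : R -> 'rV[R]_n) (f g : R -> R -> 'rV[R]_n -> 'rV[R]_n)
  (S : set 'rV[R]_n)
  (hnrm : is_norm nrm)
  (h_gt0 : 0 < h)
  (alpha1_neq0 : alpha1 != 0) (alpha2_ge0 : 0 <= alpha2)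
  (alpha12 : alpha1 <= alpha2) (beta_gt0 : 0 < beta)
  (gamma_le_beta : gamma <= beta)
  (f_lip : lipschitz_in_state nrm (dom_f R) S Lf f)
  (g_lip : lipschitz_in_state nrm (dom_g R) S Lg g)
  (contraction : Lf / `|alpha1| + Lg / beta < 1)
  (f_cont : continuous_on_dom (dom_f R) S f)
  (g_cont : continuous_on_dom (dom_g R) S g)
  (f_bnd : bounded_on_dom nrm (dom_f R) S Cf f)
  (g_bnd : bounded_on_dom nrm (dom_g R) S Cg g)
  (S_def : S = [set x | nrm x <= sup_norm nrm x0 + Cf / `|alpha1| + Cg / beta])
  (f_C1 : C1_in_time_bounded nrm (dom_f R) S f)
  (g_C1 : C1_in_time_bounded nrm (dom_g R) S g)
  (x0_bnd : bounded_on_halfline nrm x0)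
  (x0_diff : exists dx0 : R -> 'rV[R]_n,
     (forall t, 0 <= t -> has_deriv_within [set t' | 0 <= t'] x0 t (dx0 t)) /\
     bounded_on_halfline nrm dx0)
  (gamma_lt_beta : gamma < beta)
  (x : nat -> 'rV[R]_n)
  (x_sol : infinite_solution h alpha1 alpha2 beta gamma x0 f g S x)
  (xN : nat -> nat -> 'rV[R]_n)
  (xN_sol : forall N : nat,
     truncated_solution h alpha1 alpha2 beta gamma x0 f g S N (xN N)) :
  \big[Num.max/0]_(i < N.+1) nrm (xN N i - x i) @[N --> \oo] --> (0 : R).
Proof.
pose q := tail_rate h beta gamma.
pose K := (1 - (Lf / `|alpha1| + Lg / beta))^-1 * (Cg / beta).
apply: (@squeeze_cvgr _ _ _ _ (cst 0) (fun N => K * q ^+ N.+1)).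
- near=> N; apply/andP; split; first exact: bigmax_ge_id.
  exact: (truncation_error_le hnrm h_gt0 alpha2_ge0 alpha12 beta_gt0
    gamma_le_beta f_lip g_lip g_bnd contraction x_sol (xN_sol N)).
- exact: cvg_cst.
- rewrite -[0](mulr0 K). apply: cvgM; first exact: cvg_cst.
  rewrite (cvg_shiftS (fun N => q ^+ N)); apply: cvg_expr.
  rewrite ger0_norm ?expR_ge0// expR_lt1 mulNr oppr_lt0 mulr_gt0//.
  by rewrite subr_gt0 gt_max gamma_lt_beta.
Unshelve. all: by end_near. Qed.
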